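(* (Linearity.) If $A$ is a proposition, $B$ is a proposition of $\mathcal V$, $f$ is a closed proof-term of $A\multimap B$, $u_1$ and $u_2$ are two closed proof-terms of $A$, and $a\in\mathcal S$, then $$f\,(u_1\boxplus u_2)\equiv f\,u_1\boxplus f\,u_2\qquad\text{and}\qquad f\,(a\bullet u_1)\equiv a\bullet(f\,u_1).$$
   Context: The $\mathcal L_!^{\mathcal S}$-calculus. Let $\mathcal S$ be a commutative semiring, whose elements are called scalars. Propositions are generated by $A ::= \mathfrak 1\mid A\multimap A\mid A\otimes A\mid\top\mid\mathfrak 0\mid A\mathbin{\&}A\mid A\oplus A\mid {!}A$. Proof-terms, taken modulo $\alpha$-equivalence, are generated by (with $a\in\mathcal S$) $t ::= x\mid t\boxplus u\mid a\bullet t\mid a.\star\mid\delta_{\mathfrak 1}(t,u)\mid\lambda x^A.t\mid t\,u\mid t\otimes u\mid\delta_\otimes(t,x^Ay^B.u)\mid\langle\rangle\mid\delta_{\mathfrak 0}(t)\mid\langle t,u\rangle\mid\delta_{\&}^1(t,x^A.u)\mid\delta_{\&}^2(t,x^B.u)\mid\mathit{inl}(t)\mid\mathit{inr}(t)\mid\delta_\oplus(t,x^A.u,y^B.v)\mid {!}t\mid\delta_!(t,x^A.u)$. Variables before a dot are bound in the term after it; $(u/x)t$ is capture-avoiding substitution of $u$ for $x$ in $t$. Judgements $\Upsilon;\Gamma\vdash t:A$ have an intuitionistic context $\Upsilon$ and a linear context $\Gamma$ (finite sets of typed variables; $\Gamma,\Delta$ is disjoint union). Typing rules: - $\Upsilon;x^A\vdash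 x:A$; and $\Upsilon,x^A;\varnothing\vdash x:A$. - If $\Upsilon;\Gamma\vdash t:A$ and $\Upsilon;\Gamma\vdash u:A$ then $\Upsilon;\Gamma\vdash t\boxplus u:A$. If $\Upsilon;\Gamma\vdash t:A$ then $\Upsilon;\Gamma\vdash a\bullet t:A$. - $\Upsilon;\varnothing\vdash a.\star:\mathfrak 1$. If $\Upsilon;\Gamma\vdash t:\mathfrak 1$ and $\Upsilon;\Delta\vdash u:A$ then $\Upsilon;\Gamma,\Delta\vdash\delta_{\mathfrak 1}(t,u):A$. - If $\Upsilon;\Gamma,x^A\vdash t:B$ then $\Upsilon;\Gamma\vdash\lambda x^A.t:A\multimap B$. If $\Upsilon;\Gamma\vdash t:A\multimap B$ and $\Upsilon;\Delta\vdash u:A$ then $\Upsilon;\Gamma,\Delta\vdash t\,u:B$. - If $\Upsilon;\Gamma\vdash t:A$ and $\Upsilon;\Delta\vdash u:B$ then $\Upsilon;\Gamma,\Delta\vdash t\otimes u:A\otimes B$. If $\Upsilon;\Gamma\vdash t:A\otimes B$ and $\Upsilon;\Delta,x^A,y^B\vdash u:C$ then $\Upsilon;\Gamma,\Delta\vdash\delta_\otimes(t,x^Ay^B.u):C$. - $\Upsilon;\Gamma\vdash\langle\rangle:\top$. If $\Upsilon;\Gamma\vdash t:\mathfrak 0$ then $\Upsilon;\Gamma,\Delta\vdash\delta_{\mathfrak 0}(t):C$. - If $\Upsilon;\Gamma\vdash t:A$ and $\Upsilon;\Gamma\vdash u:B$ then $\Upsilon;\Gamma\vdash\langle t,u\rangle:A\mathbin{\&}B$.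 If $\Upsilon;\Gamma\vdash t:A\mathbin{\&}B$ and $\Upsilon;\Delta,x^A\vdash u:C$ (resp. $\Upsilon;\Delta,x^B\vdash u:C$) then $\Upsilon;\Gamma,\Delta\vdash\delta_{\&}^1(t,x^A.u):C$ (resp. $\delta_{\&}^2(t,x^B.u):C$). - If $\Upsilon;\Gamma\vdash t:A$ (resp. $t:B$) then $\Upsilon;\Gamma\vdash\mathit{inl}(t):A\oplus B$ (resp. $\mathit{inr}(t):A\oplus B$). If $\Upsilon;\Gamma\vdash t:A\oplus B$, $\Upsilon;\Delta,x^A\vdash u:C$ and $\Upsilon;\Delta,y^B\vdash v:C$ then $\Upsilon;\Gamma,\Delta\vdash\delta_\oplus(t,x^A.u,y^B.v):C$. - If $\Upsilon;\varnothing\vdash t:A$ then $\Upsilon;\varnothing\vdash {!}t:{!}A$. If $\Upsilon;\Gamma\vdash t:{!}A$ and $\Upsilon,x^A;\Delta\vdash u:B$ then $\Upsilon;\Gamma,\Delta\vdash\delta_!(t,x^A.u):B$. Reduction $\longrightarrow$ is the closure under arbitrary term contexts of: $\delta_{\mathfrak 1}(a.\star,t)\to a\bullet t$; $(\lambda x^A.t)\,u\to(u/x)t$; $\delta_\otimes(u\otimes v,x^Ay^B.w)\to(u/x,v/y)w$; $\delta_{\&}^i(\langle t_1,t_2\rangle,x^A.v)\to(t_i/x)v$ ($i=1,2$); $\delta_\oplus(\mathit{inl}(t),x^A.v,y^B.w)\to(t/x)v$; $\delta_\oplus(\mathit{inr}(u),x^A.v,y^B.w)\to(u/y)w$; $\delta_!({!}t,x^A.u)\to(t/x)u$;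 $a.\star\boxplus b.\star\to(a+b).\star$; $(\lambda x^A.t)\boxplus(\lambda x^A.u)\to\lambda x^A.(t\boxplus u)$; $\delta_\otimes(t\boxplus u,x^Ay^B.v)\to\delta_\otimes(t,x^Ay^B.v)\boxplus\delta_\otimes(u,x^Ay^B.v)$; $\langle\rangle\boxplus\langle\rangle\to\langle\rangle$; $\langle t,u\rangle\boxplus\langle v,w\rangle\to\langle t\boxplus v,u\boxplus w\rangle$; $\delta_\oplus(t\boxplus u,x^A.v,y^B.w)\to\delta_\oplus(t,x^A.v,y^B.w)\boxplus\delta_\oplus(u,x^A.v,y^B.w)$; $\delta_!(t\boxplus u,x^A.v)\to\delta_!(t,x^A.v)\boxplus\delta_!(u,x^A.v)$; $a\bullet b.\star\to(a\times b).\star$; $a\bullet\lambda x^A.t\to\lambda x^A.a\bullet t$; $\delta_\otimes(a\bullet t,x^Ay^B.v)\to a\bullet\delta_\otimes(t,x^Ay^B.v)$; $a\bullet\langle\rangle\to\langle\rangle$; $a\bullet\langle t,u\rangle\to\langle a\bullet t,a\bullet u\rangle$; $\delta_\oplus(a\bullet t,x^A.v,y^B.w)\to a\bullet\delta_\oplus(t,x^A.v,y^B.w)$; $\delta_!(a\bullet t,x^A.v)\to a\bullet\delta_!(t,x^A.v)$. $\equiv$ is the reflexive-symmetric-transitive closure of $\longrightarrow$. A closed proof-term of $A$ is a $t$ with $\varnothing;\varnothing\vdash t:A$. The set $\mathcal V$ of propositions is defined inductively: $\mathfrak 1\in\mathcal V$, and if $A,B\in\mathcal V$ then $A\mathbin{\&}B\in\mathcal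 V$. *)

(* Defs.v *)
From Stdlib Require Import Relations.
From mathcomp Require Import all_boot all_algebra.

Set Implicit Arguments.
Unset Strict Implicit.
Unset Printing Implicit Defensive.

Import GRing.Theory.
Local Open Scope ring_scope.

Inductive proposition : Type :=
| One
| Lolli of proposition & proposition
| Tensor of proposition & proposition
| Top
| Zero
| With of proposition & proposition
| Plus of proposition & proposition
| OfCourse of proposition.

Inductive inV : proposition -> Prop :=
| inV_One : inV One
| inV_With A B : inV A -> inV B -> inV (With A B).

(* Proof-terms modulo alpha-equivalence, with de Bruijn indices: [Var 0] is
   the innermost bound variable.  In [DTensor t A B u], that is
   delta_tensor(t, x^A y^B. u), the variable y is index 0 of u and x is
   index 1.  Free variables, linear or intuitionistic, share one index space:
   which of the two a variable is depends only on the typing context. *)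
Inductive term (S : Type) : Type :=
| Var of nat
| Sum of term S & term S
| Scal of S & term S
| Star of S
| DOne of term S & term S
| Lam of proposition & term S
| App of term S & term S
| Tens of term S & term S
| DTensor of term S & proposition & proposition & term S
| Unit
| DZero of term S
| Pair of term S & term S
| DWith1 of term S & proposition & term S
| DWith2 of term S & proposition & term S
| Inl of term S
| Inr of term S
| DPlus of term S & proposition & term S & proposition & term S
| Bang of term S
| DBang of term S & proposition & term S.

Arguments Var {S} _.
Arguments Unit {S}.

Definition up_ren (r : nat -> nat) (i : nat) : nat :=
  if i is j.+1 then (r j).+1 else 0%N.

Fixpoint rename {S : Type} (r : nat -> nat) (t : term S) : term S :=
  match t with
  | Var i => Var (r i)
  | Sum t u => Sum (rename r t) (rename r u)
  | Scal a t => Scal a (rename r t)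
  | Star a => Star a
  | DOne t u => DOne (rename r t) (rename r u)
  | Lam A t => Lam A (rename (up_ren r) t)
  | App t u => App (rename r t) (rename r u)
  | Tens t u => Tens (rename r t) (rename r u)
  | DTensor t A B u =>
      DTensor (rename r t) A B (rename (up_ren (up_ren r)) u)
  | Unit => Unit
  | DZero t => DZero (rename r t)
  | Pair t u => Pair (rename r t) (rename r u)
  | DWith1 t A u => DWith1 (rename r t) A (rename (up_ren r) u)
  | DWith2 t B u => DWith2 (rename r t) B (rename (up_ren r) u)
  | Inl t => Inl (rename r t)
  | Inr t => Inr (rename r t)
  | DPlus t A u B v =>
      DPlus (rename r t) A (rename (up_ren r) u) B (rename (up_ren r) v)
  | Bang t => Bang (rename r t)
  | DBang t A u => DBang (rename r t) A (rename (up_ren r) u)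
  end.

Definition up_sub {S : Type} (s : nat -> term S) (i : nat) : term S :=
  if i is j.+1 then rename succn (s j) else Var 0.

Fixpoint subst {S : Type} (s : nat -> term S) (t : term S) : term S :=
  match t with
  | Var i => s i
  | Sum t u => Sum (subst s t) (subst s u)
  | Scal a t => Scal a (subst s t)
  | Star a => Star a
  | DOne t u => DOne (subst s t) (subst s u)
  | Lam A t => Lam A (subst (up_sub s) t)
  | App t u => App (subst s t) (subst s u)
  | Tens t u => Tens (subst s t) (subst s u)
  | DTensor t A B u => DTensor (subst s t) A B (subst (up_sub (up_sub s)) u)
  | Unit => Unit
  | DZero t => DZero (subst s t)
  | Pair t u => Pair (subst s t) (subst s u)
  | DWith1 t A u => DWith1 (subst s t) A (subst (up_sub s) u)
  | DWith2 t B u => DWith2 (subst s t) B (subst (up_sub s) u)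
  | Inl t => Inl (subst s t)
  | Inr t => Inr (subst s t)
  | DPlus t A u B v =>
      DPlus (subst s t) A (subst (up_sub s) u) B (subst (up_sub s) v)
  | Bang t => Bang (subst s t)
  | DBang t A u => DBang (subst s t) A (subst (up_sub s) u)
  end.

Definition scons {S : Type} (u : term S) (s : nat -> term S) (i : nat) :
    term S :=
  if i is j.+1 then s j else u.

(* (u/x)t, where x is the variable of index 0 in t. *)
Definition subst1 {S : Type} (u t : term S) : term S := subst (scons u Var) t.

(* (u/x, v/y)t, where y and x are the variables of index 0 and 1 in t. *)
Definition subst2 {S : Type} (u v t : term S) : term S :=
  subst (scons v (scons u Var)) t.

(* A finite set of typed variables: the variable i is declared with type A
   when the i-th entry is [Some A], and is undeclared when that entry is [None]
   or beyond the end of the sequence. *)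
Definition context := seq (option proposition).

Definition lookup (G : context) (i : nat) : option proposition := nth None G i.

Definition is_empty (G : context) : Prop := forall i, lookup G i = None.

Definition is_singleton (G : context) (i : nat) (A : proposition) : Prop :=
  forall j, lookup G j = if j == i then Some A else None.

Definition disjoint_union (G D E : context) : Prop :=
  forall i, match lookup G i, lookup D i with
            | Some _, Some _ => False
            | Some A, None => lookup E i = Some A
            | None, o => lookup E i = o
            end.

(* [typed Y G t A] is the judgement Y; G |- t : A.  A binder adds an entry to
   both contexts, [None] in the one to which its variable does not belong. *)
Inductive typed {S : Type} :
    context -> context -> term S -> proposition -> Prop :=
| T_LVar Y G i A : is_singleton G i A -> typed Y G (Var i) A
| T_IVar Y G i A : lookup Y i = Some A -> is_empty G -> typed Y G (Var i) A
| T_Sum Y G t u A : typed Y G t A -> typed Y G u A -> typed Y G (Sum t u) A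
| T_Scal Y G a t A : typed Y G t A -> typed Y G (Scal a t) A
| T_Star Y G a : is_empty G -> typed Y G (Star a) One
| T_DOne Y G D E t u A : disjoint_union G D E ->
    typed Y G t One -> typed Y D u A -> typed Y E (DOne t u) A
| T_Lam Y G A B t :
    typed (None :: Y) (Some A :: G) t B -> typed Y G (Lam A t) (Lolli A B)
| T_App Y G D E t u A B : disjoint_union G D E ->
    typed Y G t (Lolli A B) -> typed Y D u A -> typed Y E (App t u) B
| T_Tens Y G D E t u A B : disjoint_union G D E ->
    typed Y G t A -> typed Y D u B -> typed Y E (Tens t u) (Tensor A B)
| T_DTensor Y G D E t u A B C : disjoint_union G D E ->
    typed Y G t (Tensor A B) ->
    typed (None :: None :: Y) (Some B :: Some A :: D) u C ->
    typed Y E (DTensor t A B u) C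
| T_Unit Y G : typed Y G Unit Top
| T_DZero Y G D E t C : disjoint_union G D E ->
    typed Y G t Zero -> typed Y E (DZero t) C
| T_Pair Y G t u A B :
    typed Y G t A -> typed Y G u B -> typed Y G (Pair t u) (With A B)
| T_DWith1 Y G D E t u A B C : disjoint_union G D E ->
    typed Y G t (With A B) -> typed (None :: Y) (Some A :: D) u C ->
    typed Y E (DWith1 t A u) C
| T_DWith2 Y G D E t u A B C : disjoint_union G D E ->
    typed Y G t (With A B) -> typed (None :: Y) (Some B :: D) u C ->
    typed Y E (DWith2 t B u) C
| T_Inl Y G t A B : typed Y G t A -> typed Y G (Inl t) (Plus A B)
| T_Inr Y G t A B : typed Y G t B -> typed Y G (Inr t) (Plus A B)
| T_DPlus Y G D E t u v A B C : disjoint_union G D E ->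
    typed Y G t (Plus A B) ->
    typed (None :: Y) (Some A :: D) u C ->
    typed (None :: Y) (Some B :: D) v C ->
    typed Y E (DPlus t A u B v) C
| T_Bang Y G t A :
    is_empty G -> typed Y G t A -> typed Y G (Bang t) (OfCourse A)
| T_DBang Y G D E t u A B : disjoint_union G D E ->
    typed Y G t (OfCourse A) -> typed (Some A :: Y) (None :: D) u B ->
    typed Y E (DBang t A u) B.

Definition closed_proof {S : Type} (t : term S) (A : proposition) : Prop :=
  typed [::] [::] t A.

Inductive head_step {S : comPzSemiRingType} : term S -> term S -> Prop :=
| R_One a t : head_step (DOne (Star a) t) (Scal a t)
| R_Beta A t u : head_step (App (Lam A t) u) (subst1 u t)
| R_Tensor A B u v w : head_step (DTensor (Tens u v) A B w) (subst2 u v w)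
| R_With1 A t1 t2 v : head_step (DWith1 (Pair t1 t2) A v) (subst1 t1 v)
| R_With2 B t1 t2 v : head_step (DWith2 (Pair t1 t2) B v) (subst1 t2 v)
| R_PlusL A B t v w : head_step (DPlus (Inl t) A v B w) (subst1 t v)
| R_PlusR A B u v w : head_step (DPlus (Inr u) A v B w) (subst1 u w)
| R_Bang A t u : head_step (DBang (Bang t) A u) (subst1 t u)
| R_SumStar a b : head_step (Sum (Star a) (Star b)) (Star (a + b))
| R_SumLam A t u : head_step (Sum (Lam A t) (Lam A u)) (Lam A (Sum t u))
| R_SumTensor A B t u v :
    head_step (DTensor (Sum t u) A B v) (Sum (DTensor t A B v) (DTensor u A B v))
| R_SumUnit : head_step (Sum Unit Unit) Unit
| R_SumPair t u v w :
    head_step (Sum (Pair t u) (Pair v w)) (Pair (Sum t v) (Sum u w))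
| R_SumPlus A B t u v w :
    head_step (DPlus (Sum t u) A v B w) (Sum (DPlus t A v B w) (DPlus u A v B w))
| R_SumBang A t u v :
    head_step (DBang (Sum t u) A v) (Sum (DBang t A v) (DBang u A v))
| R_ScalStar a b : head_step (Scal a (Star b)) (Star (a * b))
| R_ScalLam a A t : head_step (Scal a (Lam A t)) (Lam A (Scal a t))
| R_ScalTensor a A B t v :
    head_step (DTensor (Scal a t) A B v) (Scal a (DTensor t A B v))
| R_ScalUnit a : head_step (Scal a Unit) Unit
| R_ScalPair a t u :
    head_step (Scal a (Pair t u)) (Pair (Scal a t) (Scal a u))
| R_ScalPlus a A B t v w :
    head_step (DPlus (Scal a t) A v B w) (Scal a (DPlus t A v B w))
| R_ScalBang a A t v : head_step (DBang (Scal a t) A v) (Scal a (DBang t A v)).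

Inductive step {S : comPzSemiRingType} : term S -> term S -> Prop :=
| step_head t t' : head_step t t' -> step t t'
| step_Sum1 t t' u : step t t' -> step (Sum t u) (Sum t' u)
| step_Sum2 t u u' : step u u' -> step (Sum t u) (Sum t u')
| step_Scal a t t' : step t t' -> step (Scal a t) (Scal a t')
| step_DOne1 t t' u : step t t' -> step (DOne t u) (DOne t' u)
| step_DOne2 t u u' : step u u' -> step (DOne t u) (DOne t u')
| step_Lam A t t' : step t t' -> step (Lam A t) (Lam A t')
| step_App1 t t' u : step t t' -> step (App t u) (App t' u)
| step_App2 t u u' : step u u' -> step (App t u) (App t u')
| step_Tens1 t t' u : step t t' -> step (Tens t u) (Tens t' u)
| step_Tens2 t u u' : step u u' -> step (Tens t u) (Tens t u')
| step_DTensor1 A B t t' u :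
    step t t' -> step (DTensor t A B u) (DTensor t' A B u)
| step_DTensor2 A B t u u' :
    step u u' -> step (DTensor t A B u) (DTensor t A B u')
| step_DZero t t' : step t t' -> step (DZero t) (DZero t')
| step_Pair1 t t' u : step t t' -> step (Pair t u) (Pair t' u)
| step_Pair2 t u u' : step u u' -> step (Pair t u) (Pair t u')
| step_DWith11 A t t' u : step t t' -> step (DWith1 t A u) (DWith1 t' A u)
| step_DWith12 A t u u' : step u u' -> step (DWith1 t A u) (DWith1 t A u')
| step_DWith21 B t t' u : step t t' -> step (DWith2 t B u) (DWith2 t' B u)
| step_DWith22 B t u u' : step u u' -> step (DWith2 t B u) (DWith2 t B u')
| step_Inl t t' : step t t' -> step (Inl t) (Inl t')
| step_Inr t t' : step t t' -> step (Inr t) (Inr t')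
| step_DPlus1 A B t t' u v :
    step t t' -> step (DPlus t A u B v) (DPlus t' A u B v)
| step_DPlus2 A B t u u' v :
    step u u' -> step (DPlus t A u B v) (DPlus t A u' B v)
| step_DPlus3 A B t u v v' :
    step v v' -> step (DPlus t A u B v) (DPlus t A u B v')
| step_Bang t t' : step t t' -> step (Bang t) (Bang t')
| step_DBang1 A t t' u : step t t' -> step (DBang t A u) (DBang t' A u)
| step_DBang2 A t u u' : step u u' -> step (DBang t A u) (DBang t A u').

Definition term_equiv {S : comPzSemiRingType} : term S -> term S -> Prop :=
  clos_refl_sym_trans (term S) step.

(* Main.v *)
(* Propositions are interpreted as S-semimodules presented as setoids: 1 as S,
   -o as linear maps, & as product, and the tensor, + and ! as formal linear
   combinations of generators modulo the smallest congruence that makes the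
   generators bilinear, linear, resp. unconstrained.  A realizability relation
   [real A t m], "t computes m", is stable under the syntactic sum and scalar
   multiplication, and each typed term realizes a map that is linear in its
   linear variables.  For B in V, a realizer is determined up to conversion by
   the element that it realizes, so that linearity of the interpretation of f
   becomes convertibility.  No normalization argument is involved. *)
Require Import Defs.
From Stdlib Require Import Relations Setoid Morphisms.
From mathcomp Require Import all_boot all_algebra.

Set Implicit Arguments.
Unset Strict Implicit.
Unset Printing Implicit Defensive.

Import GRing.Theory.

(** * Substitution *)

Section Substitution.
Context {S : Type}.
Implicit Types (t u v : term S) (s : nat -> term S) (r : nat -> nat).

(** The composite is a separate map [r2], specified pointwise: lifting under a binder commutes with
    composition only pointwise, and this form lets the induction pass through binders without
    functional extensionality. The next three lemmas follow the same pattern. *)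
Lemma rename_rename t r r' r2 :
  (forall i, r (r' i) = r2 i) -> rename r (rename r' t) = rename r2 t.
Proof.
have up q q' q2 : (forall i, q (q' i) = q2 i) ->
    forall i, up_ren q (up_ren q' i) = up_ren q2 i by move=> e [|i] //=; rewrite e.
by elim: t r r' r2 => //= *; f_equal; auto.
Qed.

Lemma subst_rename t s r s2 :
  (forall i, s (r i) = s2 i) -> subst s (rename r t) = subst s2 t.
Proof.
have up q q' q2 : (forall i, q (q' i) = q2 i) ->
    forall i, up_sub q (up_ren q' i) = up_sub q2 i by move=> e [|i] //=; rewrite e.
by elim: t s r s2 => //= *; f_equal; auto.
Qed.

Lemma rename_subst t s r s2 :
  (forall i, rename r (s i) = s2 i) -> rename r (subst s t) = subst s2 t.
Proof.
have up q (q' q2 : nat -> term S) : (forall i, rename q (q' i) = q2 i) ->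
    forall i, rename (up_ren q) (up_sub q' i) = up_sub q2 i.
  move=> e [|i] //=; rewrite -e.
  transitivity (rename (fun i => (q i).+1) (q' i)); first exact: rename_rename.
  exact/esym/rename_rename.
by elim: t s r s2 => //= *; f_equal; auto.
Qed.

Lemma subst_subst t s s' s2 :
  (forall i, subst s (s' i) = s2 i) -> subst s (subst s' t) = subst s2 t.
Proof.
have up (q q' q2 : nat -> term S) : (forall i, subst q (q' i) = q2 i) ->
    forall i, subst (up_sub q) (up_sub q' i) = up_sub q2 i.
  move=> e [|i] //=; rewrite -e (rename_subst _ (fun i => erefl (rename succn (q i)))).
  exact: subst_rename.
by elim: t s s' s2 => //= *; f_equal; auto.
Qed.

Lemma subst_Var t s : s =1 Var -> subst s t = t.
Proof.
have up (q : nat -> term S) : q =1 Var -> up_sub q =1 Var by move=> e [|i] //=; rewrite e.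
by elim: t s => //= *; f_equal; auto.
Qed.

(** Contracting a redex after a closing substitution [s] amounts to extending [s] by the argument,
    which is the form in which the induction hypothesis on the body is available in the soundness
    proof. *)
Lemma subst1_up t u s : subst1 u (subst (up_sub s) t) = subst (scons u s) t.
Proof.
apply: subst_subst => -[|i] //=.
by rewrite (subst_rename _ (s2 := Var)) // subst_Var.
Qed.

Lemma subst2_up t u v s :
  subst2 u v (subst (up_sub (up_sub s)) t) = subst (scons v (scons u s)) t.
Proof.
apply: subst_subst => -[|[|i]] //=.
rewrite (subst_rename _ (s2 := scons u Var)) //.
by rewrite (subst_rename _ (s2 := Var)) // subst_Var.
Qed.

End Substitution.

(** * Setoid semimodules *)

(* No zero is required, which lets the proposition 0 be interpreted by the empty
   type, and 1 need not act as the identity: t and 1.t are not convertible. *)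
Record semimod (S : comPzSemiRingType) := Semimod {
  car :> Type;
  eqm : car -> car -> Prop;
  addm : car -> car -> car;
  scalm : S -> car -> car;
  eqm_equiv : Equivalence eqm;
  addm_proper : Proper (eqm ==> eqm ==> eqm) addm;
  scalm_proper a : Proper (eqm ==> eqm) (scalm a);
  addmC x y : eqm (addm x y) (addm y x);
  addmA x y z : eqm (addm x (addm y z)) (addm (addm x y) z);
  scalmDl a b x : eqm (scalm (a + b)%R x) (addm (scalm a x) (scalm b x));
  scalmDr a x y : eqm (scalm a (addm x y)) (addm (scalm a x) (scalm a y));
  scalmA a b x : eqm (scalm (a * b)%R x) (scalm a (scalm b x))
}.

#[local] Existing Instance eqm_equiv.
#[local] Existing Instance addm_proper.
#[local] Existing Instance scalm_proper.
#[local] Hint Extern 0 (eqm _ _) => reflexivity : core.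

Notation "x =m y" := (eqm x y) (at level 70).
Notation "x +m y" := (addm x y) (at level 50, left associativity).
Notation "a *m x" := (scalm a x) (at level 40, left associativity).

Section Semimodules.
Context {S : comPzSemiRingType}.
Implicit Types (M N P : semimod S) (a b : S).

Lemma addmACA M (x y z w : M) : (x +m y) +m (z +m w) =m (x +m z) +m (y +m w).
Proof. by rewrite addmA -(addmA x y z) (addmC y z) addmA -addmA. Qed.

Lemma scalmCA M a b (x : M) : a *m (b *m x) =m b *m (a *m x).
Proof. by rewrite -!scalmA mulrC. Qed.

Record is_linear M N (f : M -> N) : Prop := IsLinear {
  lin_congr : Proper (@eqm _ M ==> @eqm _ N) f;
  lin_add x y : f (x +m y) =m f x +m f y;
  lin_scal a x : f (a *m x) =m a *m f x
}.

Definition bilinear M N P (op : M -> N -> P) : Prop :=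
  (forall y, is_linear (op^~ y)) /\ (forall x, is_linear (op x)).

Program Definition scalars : semimod S :=
  @Semimod S S eq (fun x y => (x + y)%R) (fun a x => (a * x)%R) _ _ _ _ _ _ _ _.
Next Obligation. by rewrite addrC. Qed.
Next Obligation. by rewrite addrA. Qed.
Next Obligation. by rewrite mulrDl. Qed.
Next Obligation. by rewrite mulrDr. Qed.
Next Obligation. by rewrite mulrA. Qed.

Program Definition trivial : semimod S :=
  @Semimod S unit eq (fun _ _ => tt) (fun _ _ => tt)
    _ _ _ _ _ _ _ _.

Program Definition empty : semimod S :=
  @Semimod S void eq (fun x _ => x) (fun _ x => x)
    _ _ _ _ _ _ _ _.
Next Obligation. by case: x. Qed.

Program Definition product M N : semimod S :=
  @Semimod S (M * N)%type (fun p q => p.1 =m q.1 /\ p.2 =m q.2)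
    (fun p q => (p.1 +m q.1, p.2 +m q.2)) (fun a p => (a *m p.1, a *m p.2))
    _ _ _ _ _ _ _ _.
Next Obligation.
by split=> [p|p q [e1 e2]|p q r [e1 e2] [e3 e4]] //; split; rewrite ?e1 ?e2.
Qed.
Next Obligation. by move=> p p' [e1 e2] q q' [e3 e4]; split; rewrite /= ?e1 ?e3 ?e2 ?e4. Qed.
Next Obligation. by move=> p p' [e1 e2]; split; rewrite /= ?e1 ?e2. Qed.
Next Obligation. by split; apply: addmC. Qed.
Next Obligation. by split; apply: addmA. Qed.
Next Obligation. by split; apply: scalmDl. Qed.
Next Obligation. by split; apply: scalmDr. Qed.
Next Obligation. by split; apply: scalmA. Qed.

Record linmap M N := LinMap { lfun :> M -> N; lfunP : is_linear lfun }.

Program Definition hom M N : semimod S :=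
  @Semimod S (linmap M N) (fun f g => forall x, f x =m g x)
    (fun f g => @LinMap M N (fun x => f x +m g x) _)
    (fun a f => @LinMap M N (fun x => a *m f x) _) _ _ _ _ _ _ _ _.
Next Obligation.
have [f1 f2 f3] := lfunP f; have [g1 g2 g3] := lfunP g.
split=> [x y e|x y|a x]; first by rewrite e.
- by rewrite f2 g2 addmACA.
- by rewrite f3 g3 scalmDr.
Qed.
Next Obligation.
have [f1 f2 f3] := lfunP f.
split=> [x y e|x y|b x]; first by rewrite e.
- by rewrite f2 scalmDr.
- by rewrite f3 scalmCA.
Qed.
Next Obligation. by split=> [f|f g e x|f g h e e' x] //; rewrite e. Qed.
Next Obligation. by move=> f f' e g g' e' x /=; rewrite e e'. Qed.
Next Obligation. by move=> f f' e x /=; rewrite e. Qed.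
Next Obligation. exact: addmC. Qed.
Next Obligation. exact: addmA. Qed.
Next Obligation. exact: scalmDl. Qed.
Next Obligation. exact: scalmDr. Qed.
Next Obligation. exact: scalmA. Qed.

(** These maps interpret the body of [DBang], which may use its intuitionistic variable any number
    of times and so need not be linear in it. *)
Record setoidmap M N := SetoidMap {
  sfun :> M -> N; sfunP : Proper (@eqm _ M ==> @eqm _ N) sfun }.

Program Definition maps M N : semimod S :=
  @Semimod S (setoidmap M N) (fun f g => forall x, f x =m g x)
    (fun f g => @SetoidMap M N (fun x => f x +m g x) _)
    (fun a f => @SetoidMap M N (fun x => a *m f x) _) _ _ _ _ _ _ _ _.
Next Obligation. by move=> x y e; rewrite (sfunP f e) (sfunP g e). Qed.
Next Obligation. by move=> x y e; rewrite (sfunP f e). Qed.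
Next Obligation. by split=> [f|f g e x|f g h e e' x] //; rewrite e. Qed.
Next Obligation. by move=> f f' e g g' e' x /=; rewrite e e'. Qed.
Next Obligation. by move=> f f' e x /=; rewrite e. Qed.
Next Obligation. exact: addmC. Qed.
Next Obligation. exact: addmA. Qed.
Next Obligation. exact: scalmDl. Qed.
Next Obligation. exact: scalmDr. Qed.
Next Obligation. exact: scalmA. Qed.

(** * Semimodules given by generators and relations *)

Inductive tree (X : Type) : Type :=
| Leaf of X
| TAdd of tree X & tree X
| TScal of S & tree X.

Inductive teq X (R : tree X -> tree X -> Prop) : tree X -> tree X -> Prop :=
| teq_gen p q : R p q -> teq R p q
| teq_refl p : teq R p p
| teq_sym p q : teq R p q -> teq R q p
| teq_trans p q r : teq R p q -> teq R q r -> teq R p r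
| teq_add p p' q q' : teq R p p' -> teq R q q' -> teq R (TAdd p q) (TAdd p' q')
| teq_scal a p p' : teq R p p' -> teq R (TScal a p) (TScal a p')
| teq_addC p q : teq R (TAdd p q) (TAdd q p)
| teq_addA p q r : teq R (TAdd p (TAdd q r)) (TAdd (TAdd p q) r)
| teq_scalDl a b p : teq R (TScal (a + b)%R p) (TAdd (TScal a p) (TScal b p))
| teq_scalDr a p q : teq R (TScal a (TAdd p q)) (TAdd (TScal a p) (TScal a q))
| teq_scalA a b p : teq R (TScal (a * b)%R p) (TScal a (TScal b p)).

Definition presented X (R : tree X -> tree X -> Prop) : semimod S.
Proof.
refine (@Semimod S (tree X) (teq R) (@TAdd X) (@TScal X) _ _ _ _ _ _ _ _).
- split=> [p|p q|p q r]; [exact: teq_refl|exact: teq_sym|exact: teq_trans].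
- by move=> p p' e q q' e'; apply: teq_add.
- by move=> a p p' e; apply: teq_scal.
- exact: teq_addC.
- exact: teq_addA.
- exact: teq_scalDl.
- exact: teq_scalDr.
- exact: teq_scalA.
Defined.

Fixpoint fold X M (h : X -> M) (p : tree X) : M :=
  match p with
  | Leaf x => h x
  | TAdd p q => fold h p +m fold h q
  | TScal a p => a *m fold h p
  end.

(** Universal property of the presentation: every constructor of [teq] other than [teq_gen] is a law
    valid in [M], so only the relations [R] remain to be checked. *)
Lemma fold_linear X (R : tree X -> tree X -> Prop) M (h : X -> M) :
  (forall p q, R p q -> fold h p =m fold h q) ->
  is_linear (fold h : presented R -> M).
Proof.
move=> hR; split=> // p q; elim=> {p q} //=.
- by move=> p q _ ->.
- by move=> p q r _ -> _ ->.
- by move=> p p' q q' _ -> _ ->.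
- by move=> a p p' _ ->.
- by move=> p q; rewrite addmC.
- by move=> p q r; rewrite addmA.
- by move=> a b p; rewrite scalmDl.
- by move=> a p q; rewrite scalmDr.
- by move=> a b p; rewrite scalmA.
Qed.

(** For a fixed tree, the fold is built from the maps [h x] by sums and scalings, and these preserve
    linearity; for scalings this rests on the commutativity of [S]. *)
Lemma fold_linear_r X M N (h : X -> N -> M) (p : tree X) :
  (forall x, is_linear (h x)) -> is_linear (fun g => fold (h^~ g) p).
Proof.
move=> hl; elim: p => [x|p [p1 p2 p3] q [q1 q2 q3]|a p [p1 p2 p3]] /=; first exact: hl.
- split=> [g g' e|g g'|a g]; first by rewrite (p1 _ _ e) (q1 _ _ e).
  + by rewrite p2 q2 addmACA.
  + by rewrite p3 q3 scalmDr.
- split=> [g g' e|g g'|b g]; first by rewrite (p1 _ _ e).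
  + by rewrite p2 scalmDr.
  + by rewrite p3 scalmCA.
Qed.

Inductive tensor_rel M N : tree (M * N) -> tree (M * N) -> Prop :=
| tensor_congr x x' y y' :
    x =m x' -> y =m y' -> tensor_rel (Leaf (x, y)) (Leaf (x', y'))
| tensor_addl x x' y :
    tensor_rel (Leaf (x +m x', y)) (TAdd (Leaf (x, y)) (Leaf (x', y)))
| tensor_addr x y y' :
    tensor_rel (Leaf (x, y +m y')) (TAdd (Leaf (x, y)) (Leaf (x, y')))
| tensor_scall a x y : tensor_rel (Leaf (a *m x, y)) (TScal a (Leaf (x, y)))
| tensor_scalr a x y : tensor_rel (Leaf (x, a *m y)) (TScal a (Leaf (x, y))).

Definition tensor M N : semimod S := presented (@tensor_rel M N).

Inductive plus_rel M N : tree (M + N) -> tree (M + N) -> Prop :=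
| plus_congrl x x' : x =m x' -> plus_rel (Leaf (inl x)) (Leaf (inl x'))
| plus_congrr y y' : y =m y' -> plus_rel (Leaf (inr y)) (Leaf (inr y'))
| plus_addl x x' :
    plus_rel (Leaf (inl (x +m x'))) (TAdd (Leaf (inl x)) (Leaf (inl x')))
| plus_addr y y' :
    plus_rel (Leaf (inr (y +m y'))) (TAdd (Leaf (inr y)) (Leaf (inr y')))
| plus_scall a x : plus_rel (Leaf (inl (a *m x))) (TScal a (Leaf (inl x)))
| plus_scalr a y : plus_rel (Leaf (inr (a *m y))) (TScal a (Leaf (inr y))).

Definition plus M N : semimod S := presented (@plus_rel M N).

(** Only the setoid equality of [M] is imposed, so [bang M] is the free semimodule on the underlying
    setoid of [M]: its sums are unrelated to those of [M]. *)
Inductive bang_rel M : tree M -> tree M -> Prop :=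
| bang_congr x x' : x =m x' -> bang_rel (Leaf x) (Leaf x').

Definition bang M : semimod S := presented (@bang_rel M).

(** * Linear and bilinear operations interpreting the typing rules *)

Lemma scal_bilinear M : bilinear (fun (a : scalars) (x : M) => a *m x).
Proof.
split=> [x|a]; split=> [y z e|y z|b y].
- by rewrite [y]e.
- exact: scalmDl.
- exact: scalmA.
- by rewrite e.
- exact: scalmDr.
- exact: scalmCA.
Qed.

Lemma app_bilinear M N : bilinear (fun (f : hom M N) (x : M) => f x).
Proof. by split=> [x|f]; [split=> // f g e | exact: lfunP]. Qed.

Lemma tensor_bilinear M N : bilinear (fun x y => Leaf (x, y) : tensor M N).
Proof.
split=> [y|x]; split=> [z z' e|z z'|a z]; apply: teq_gen.
- exact: tensor_congr.
- exact: tensor_addl.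
- exact: tensor_scall.
- exact: tensor_congr.
- exact: tensor_addr.
- exact: tensor_scalr.
Qed.

(** Linearity in the tensor is the universal property, where bilinearity of the curried body [g]
    validates [tensor_rel]; linearity in [g] holds tree by tree. The eliminations of [plus] and
    [bang] go the same way. *)
Lemma tensor_elim_bilinear M N P :
  bilinear (fun (p : tensor M N) (g : hom M (hom N P)) =>
              fold (fun xy => g xy.1 xy.2) p).
Proof.
split=> [g|p]; last first.
  apply: (@fold_linear_r _ P (hom M (hom N P)) (fun xy g => g xy.1 xy.2)).
  by move=> [x y]; split=> // g g' e; apply: e.
apply: fold_linear => _ _ [x x' y y' ex ey|x x' y|x y y'|a x y|a x y] /=.
- by rewrite (lin_congr (lfunP (g x)) ey) (lin_congr (lfunP g) ex y').
- exact: (lin_add (lfunP g)).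
- exact: (lin_add (lfunP (g x))).
- exact: (lin_scal (lfunP g)).
- exact: (lin_scal (lfunP (g x))).
Qed.

Lemma proj_bilinear1 M N P :
  bilinear (fun (p : product M N) (g : hom M P) => g p.1).
Proof.
split=> [g|p]; last by split=> // g g' e.
split=> [p q [e _]|p q|a p] /=; first by rewrite (lin_congr (lfunP g) e).
- exact: (lin_add (lfunP g)).
- exact: (lin_scal (lfunP g)).
Qed.

Lemma proj_bilinear2 M N P :
  bilinear (fun (p : product M N) (g : hom N P) => g p.2).
Proof.
split=> [g|p]; last by split=> // g g' e.
split=> [p q [_ e]|p q|a p] /=; first by rewrite (lin_congr (lfunP g) e).
- exact: (lin_add (lfunP g)).
- exact: (lin_scal (lfunP g)).
Qed.

Definition case_sum M N P (g : product (hom M P) (hom N P)) (x : M + N) : P :=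
  match x with inl x => g.1 x | inr y => g.2 y end.

Lemma plus_elim_bilinear M N P :
  bilinear (fun (p : plus M N) (g : product (hom M P) (hom N P)) =>
              fold (case_sum g) p).
Proof.
split=> [g|p]; last first.
  apply: (@fold_linear_r _ P (product (hom M P) (hom N P)) (fun x g => case_sum g x)).
  by move=> [x|y]; split=> // g g' [e e'] /=.
apply: fold_linear => _ _ [x x' e|x x' e|x x'|x x'|a x|a x] /=.
- by rewrite (lin_congr (lfunP g.1) e).
- by rewrite (lin_congr (lfunP g.2) e).
- exact: (lin_add (lfunP g.1)).
- exact: (lin_add (lfunP g.2)).
- exact: (lin_scal (lfunP g.1)).
- exact: (lin_scal (lfunP g.2)).
Qed.

Lemma bang_elim_bilinear M P :
  bilinear (fun (p : bang M) (g : maps M P) => fold g p).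
Proof.
split=> [g|p]; last first.
  apply: (@fold_linear_r _ P (maps M P) (fun x g => g x)).
  by move=> x; split=> // g g' e; apply: e.
by apply: fold_linear => _ _ [x x' e] /=; apply: sfunP.
Qed.

Lemma inl_linear M N : is_linear (fun x => Leaf (inl x) : plus M N).
Proof.
by split=> [x x' e|x x'|a x]; apply: teq_gen; [exact: plus_congrl|exact: plus_addl|exact: plus_scall].
Qed.

Lemma inr_linear M N : is_linear (fun x => Leaf (inr x) : plus M N).
Proof.
by split=> [x x' e|x x'|a x]; apply: teq_gen; [exact: plus_congrr|exact: plus_addr|exact: plus_scalr].
Qed.

(** * Interpretation and realizability *)

Fixpoint interp (A : proposition) : semimod S :=
  match A with
  | One => scalars
  | Lolli A B => hom (interp A) (interp B)
  | Tensor A B => tensor (interp A) (interp B)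
  | Top => trivial
  | Zero => empty
  | With A B => product (interp A) (interp B)
  | Plus A B => plus (interp A) (interp B)
  | OfCourse A => bang (interp A)
  end.

#[local] Instance term_equiv_equiv : Equivalence (@term_equiv S).
Proof.
split=> [t|t u|t u v]; [exact: rst_refl|exact: rst_sym|exact: rst_trans].
Qed.

#[local] Hint Extern 0 (term_equiv _ _) => reflexivity : core.

Lemma step_equiv (t u : term S) : step t u -> term_equiv t u.
Proof. exact: rst_step. Qed.

Lemma head_equiv (t u : term S) : head_step t u -> term_equiv t u.
Proof. by move=> h; apply/step_equiv/step_head. Qed.

Lemma equiv_ctx (C : term S -> term S) :
  (forall t u, step t u -> step (C t) (C u)) ->
  Proper (@term_equiv S ==> @term_equiv S) C.
Proof.
move=> hC t u; elim=> {t u} [t u h|t|t u _ ->|t u v _ -> _ ->] //.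
exact/step_equiv/hC.
Qed.

#[local] Instance Sum_proper :
  Proper (@term_equiv S ==> @term_equiv S ==> @term_equiv S) (@Sum S).
Proof.
move=> t t' e u u' e'; transitivity (Sum t' u).
- by apply: (equiv_ctx (C := fun t => Sum t u)) e => *; apply: step_Sum1.
- by apply: equiv_ctx e' => *; apply: step_Sum2.
Qed.

#[local] Instance Pair_proper :
  Proper (@term_equiv S ==> @term_equiv S ==> @term_equiv S) (@Pair S).
Proof.
move=> t t' e u u' e'; transitivity (Pair t' u).
- by apply: (equiv_ctx (C := fun t => Pair t u)) e => *; apply: step_Pair1.
- by apply: equiv_ctx e' => *; apply: step_Pair2.
Qed.

#[local] Instance Scal_proper a :
  Proper (@term_equiv S ==> @term_equiv S) (Scal a).
Proof. by apply: equiv_ctx => *; apply: step_Scal. Qed.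

#[local] Instance App_proper :
  Proper (@term_equiv S ==> eq ==> @term_equiv S) (@App S).
Proof.
move=> t t' e u _ <-.
by apply: (equiv_ctx (C := fun t => App t u)) e => *; apply: step_App1.
Qed.

(** No reduction moves a sum or a scalar through [Tens], [Inl], [Inr] or [Bang]. At these types a
    term therefore computes a formal combination of introductions, whose shape is recorded by the
    tree. *)
Fixpoint treal X (P : term S -> X -> Prop) (t : term S) (p : tree X) : Prop :=
  match p with
  | Leaf x => P t x
  | TAdd p q =>
      exists t1 t2, [/\ term_equiv t (Sum t1 t2), treal P t1 p & treal P t2 q]
  | TScal a p => exists2 t1, term_equiv t (Scal a t1) & treal P t1 p
  end.

(** The clause for [Lolli] also demands convertibility to an abstraction, because a sum or scalar
    multiple of functions can be pushed through an application only once the functions are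
    abstractions. *)
Fixpoint real (A : proposition) : term S -> interp A -> Prop :=
  match A return term S -> interp A -> Prop with
  | One => fun t m => term_equiv t (Star m)
  | Lolli A B => fun t f =>
      (exists t', term_equiv t (Lam A t')) /\
      forall u m, real u m -> real (App t u) (f m)
  | Tensor A B => treal (fun t xy =>
      exists u v, [/\ term_equiv t (Tens u v), real u xy.1 & real v xy.2])
  | Top => fun t _ => term_equiv t Unit
  | Zero => fun _ _ => False
  | With A B => fun t p =>
      exists u v, [/\ term_equiv t (Pair u v), real u p.1 & real v p.2]
  | Plus A B => treal (fun t x =>
      match x with
      | inl x => exists2 u, term_equiv t (Inl u) & real u x
      | inr y => exists2 u, term_equiv t (Inr u) & real u y
      end)
  | OfCourse A => treal (fun t x => exists2 u, term_equiv t (Bang u) & real u x)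
  end.

Lemma treal_equiv X (P : term S -> X -> Prop) (p : tree X) t t' :
  (forall u u' x, term_equiv u u' -> P u x -> P u' x) ->
  term_equiv t t' -> treal P t p -> treal P t' p.
Proof.
move=> hP e; case: p => [x|p q|a p] /=; first exact: hP.
- by move=> [t1 [t2 [e' h1 h2]]]; exists t1, t2; split; rewrite -?e.
- by move=> [t1 e' h1]; exists t1; rewrite -?e.
Qed.

(** Stability is in the term only. Stability under [=m] in the element is not claimed, since trees
    identified by [=m] may have different shapes. *)
Lemma real_equiv A t t' (m : interp A) :
  term_equiv t t' -> real t m -> real t' m.
Proof.
elim: A t t' m => [|A IHA B IHB|A IHA B IHB|||A IHA B IHB|A IHA B IHB|A IHA] t t' m e /=.
- by rewrite e.
- move=> [[u eu] h]; split; first by exists u; rewrite -e.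
  by move=> v n hv; apply: (IHB _ _ _ _ (h v n hv)); rewrite e.
- by apply: treal_equiv e => u u' x e [v [w [e' hv hw]]]; exists v, w; split; rewrite -?e.
- by rewrite e.
- by [].
- by move=> [u [v [eu hu hv]]]; exists u, v; split; rewrite -?e.
- by apply: treal_equiv e => u u' [x|x] e [v e' hv]; exists v; rewrite -?e.
- by apply: treal_equiv e => u u' x e [v e' hv]; exists v; rewrite -?e.
Qed.

Lemma real_add A t u (m n : interp A) :
  real t m -> real u n -> real (Sum t u) (m +m n).
Proof.
elim: A t u m n => [|A IHA B IHB|A IHA B IHB|||A IHA B IHB|A IHA B IHB|A IHA] t u m n /=.
- by move=> -> ->; apply/head_equiv/R_SumStar.
- move=> [[t' et] ht] [[u' eu] hu].
  have e : term_equiv (Sum t u) (Lam A (Sum t' u')).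
    by rewrite et eu; apply/head_equiv/R_SumLam.
  split; first by eexists; exact: e.
  (* After beta, [App (Sum t u) v] and [Sum (App t v) (App u v)] both become the sum of the two
     instantiated bodies. *)
  move=> v k hv; apply: (real_equiv _ (IHB _ _ _ _ (ht v k hv) (hu v k hv))).
  rewrite e et eu; symmetry.
  by rewrite (head_equiv (R_Beta _ _ _)) (head_equiv (R_Beta _ t' v)) (head_equiv (R_Beta _ u' v)).
- by move=> ht hu; exists t, u.
- by move=> -> ->; apply/head_equiv/R_SumUnit.
- by [].
- move=> [t1 [t2 [et ht1 ht2]]] [u1 [u2 [eu hu1 hu2]]].
  exists (Sum t1 u1), (Sum t2 u2); split; [|exact: IHA|exact: IHB].
  by rewrite et eu; apply/head_equiv/R_SumPair.
- by move=> ht hu; exists t, u.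
- by move=> ht hu; exists t, u.
Qed.

Lemma real_scal A a t (m : interp A) : real t m -> real (Scal a t) (a *m m).
Proof.
elim: A t m => [|A IHA B IHB|A IHA B IHB|||A IHA B IHB|A IHA B IHB|A IHA] t m /=.
- by move=> ->; apply/head_equiv/R_ScalStar.
- move=> [[t' et] ht].
  have e : term_equiv (Scal a t) (Lam A (Scal a t')).
    by rewrite et; apply/head_equiv/R_ScalLam.
  split; first by eexists; exact: e.
  move=> v k hv; apply: (real_equiv _ (IHB _ _ (ht v k hv))).
  rewrite e et; symmetry.
  by rewrite (head_equiv (R_Beta _ _ _)) (head_equiv (R_Beta _ t' v)).
- by move=> ht; exists t.
- by move=> ->; apply/head_equiv/R_ScalUnit.
- by [].
- move=> [t1 [t2 [et ht1 ht2]]].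
  exists (Scal a t1), (Scal a t2); split; [|exact: IHA|exact: IHB].
  by rewrite et; apply/head_equiv/R_ScalPair.
- by move=> ht; exists t.
- by move=> ht; exists t.
Qed.

(** [C] is an elimination context that commutes with sums and scalars, so it can be pushed down the
    tree to the leaves, where [hP] applies. *)
Lemma treal_fold X (P : term S -> X -> Prop) A (C : term S -> term S)
    (h : X -> interp A) t p :
  (forall t u, step t u -> step (C t) (C u)) ->
  (forall t u, head_step (C (Sum t u)) (Sum (C t) (C u))) ->
  (forall a t, head_step (C (Scal a t)) (Scal a (C t))) ->
  (forall t x, P t x -> real (C t) (h x)) ->
  treal P t p -> real (C t) (fold h p).
Proof.
move=> /equiv_ctx hC Cadd Cscal hP; elim: p t => [x|p IHp q IHq|a p IHp] t /=.
- exact: hP.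
- move=> [t1 [t2 [e /IHp h1 /IHq h2]]]; apply: (real_equiv _ (real_add h1 h2)).
  by symmetry; rewrite (hC _ _ e) (head_equiv (Cadd _ _)).
- move=> [t1 e /IHp h1]; apply: (real_equiv _ (real_scal a h1)).
  by symmetry; rewrite (hC _ _ e) (head_equiv (Cscal _ _)).
Qed.

(** Propositions of V involve neither functions nor trees: at [One], [=m] is Leibniz equality and
    the element is the scalar of the star, and at [With] the components are compared. *)
Lemma real_inV B t t' (m m' : interp B) :
  inV B -> m =m m' -> real t m -> real t' m' -> term_equiv t t'.
Proof.
move=> hB; elim: hB t t' m m' => {B} [|A B _ IHA _ IHB] t t' m m' /=.
  by move=> -> -> ->.
move=> [e1 e2] [u [v [-> hu hv]]] [u' [v' [-> hu' hv']]].
by rewrite (IHA _ _ _ _ e1 hu hu') (IHB _ _ _ _ e2 hv hv').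
Qed.

(** * Environments *)

(* A single assignment [g] of propositions to all indices types the variables
   of both contexts; its values at undeclared indices are irrelevant. *)
Definition env (g : nat -> proposition) := forall i, interp (g i).

Definition tcons (A : proposition) (g : nat -> proposition) (i : nat) :=
  if i is j.+1 then g j else A.

Definition econs A g (m : interp A) (e : env g) : env (tcons A g) :=
  fun i => match i return interp (tcons A g i) with
           | 0 => m
           | j.+1 => e j
           end.

Section Env.
Context (g : nat -> proposition).
Implicit Types (Y G D E : context) (e : env g) (A B : proposition).

(** Sums and multiples in coordinate [i] are expressed by relating several environments, which
    avoids updating a dependent function. An index may be declared in both contexts; the guard on
    [Y] excludes it, since an intuitionistic use destroys linearity. *)
Record multilinear Y G M (F : env g -> M) : Prop := Multilinear {
  ml_congr e e' :
    (forall i, lookup Y i || lookup G i -> e i =m e' i) -> F e =m F e';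
  ml_add i e e1 e2 : lookup G i -> ~~ lookup Y i ->
    (forall j, j != i -> e j =m e1 j /\ e j =m e2 j) ->
    e i =m e1 i +m e2 i -> F e =m F e1 +m F e2;
  ml_scal i a e e1 : lookup G i -> ~~ lookup Y i ->
    (forall j, j != i -> e j =m e1 j) ->
    e i =m a *m e1 i -> F e =m a *m F e1
}.

Lemma ml_linear Y G M N (F : env g -> M) (h : M -> N) :
  is_linear h -> multilinear Y G F -> multilinear Y G (fun e => h (F e)).
Proof.
move=> [h1 h2 h3] [F1 F2 F3]; split=> [e e' he|i e e1 e2 Gi Yi he hi|i a e e1 Gi Yi he hi].
- by rewrite (h1 _ _ (F1 _ _ he)).
- by rewrite (h1 _ _ (F2 _ _ _ _ Gi Yi he hi)).
- by rewrite (h1 _ _ (F3 _ _ _ _ Gi Yi he hi)).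
Qed.

(** Both components may share [G], because the operations of a product are componentwise. *)
Lemma ml_pair Y G M N (F : env g -> M) (H : env g -> N) :
  multilinear Y G F -> multilinear Y G H ->
  multilinear Y G (fun e => (F e, H e) : product M N).
Proof.
move=> [F1 F2 F3] [H1 H2 H3]; split=> [e e' h|i e e1 e2 Gi Yi h hi|i a e e1 Gi Yi h hi].
- by split; [exact: F1|exact: H1].
- by split; [exact: F2 hi|exact: H2 hi].
- by split; [exact: F3 hi|exact: H3 hi].
Qed.

Lemma du_l G D E i : disjoint_union G D E -> lookup G i -> lookup E i = lookup G i.
Proof.
move=> /(_ i); case: (lookup G i) => // A; by case: (lookup D i).
Qed.

Lemma du_r G D E i : disjoint_union G D E -> lookup D i -> lookup E i = lookup D i.
Proof.
move=> /(_ i); case: (lookup G i) => [A|] //; by case: (lookup D i).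
Qed.

Lemma du_cases G D E i : disjoint_union G D E -> lookup E i ->
  (lookup G i /\ ~~ lookup D i) \/ (lookup D i /\ ~~ lookup G i).
Proof.
move=> /(_ i); case: (lookup G i) => [A|]; case: (lookup D i) => [B|] //.
- by left.
- by right.
- by move=> ->.
Qed.

Lemma du_vars_l Y G D E i : disjoint_union G D E ->
  lookup Y i || lookup G i -> lookup Y i || lookup E i.
Proof. by move=> du /orP[->//|Gi]; rewrite (du_l du Gi) Gi orbT. Qed.

Lemma du_vars_r Y G D E i : disjoint_union G D E ->
  lookup Y i || lookup D i -> lookup Y i || lookup E i.
Proof. by move=> du /orP[->//|Di]; rewrite (du_r du Di) Di orbT. Qed.

Lemma ml_bilinear Y G D E M N P (F : env g -> M) (H : env g -> N)
    (op : M -> N -> P) :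
  disjoint_union G D E -> bilinear op ->
  multilinear Y G F -> multilinear Y D H ->
  multilinear Y E (fun e => op (F e) (H e)).
Proof.
move=> du [opl opr] [F1 F2 F3] [H1 H2 H3].
have cl y := lin_congr (opl y); have cr x := lin_congr (opr x).
(* An index seen by the factor that does not own [i] differs from [i], so the environments agree
   there. *)
have other (X : context) i j : ~~ lookup Y i -> ~~ lookup X i ->
    lookup Y j || lookup X j -> j != i.
  by move=> Yi Xi; apply: contraTneq => ->; rewrite negb_or Yi.
split=> [e e' h|i e e1 e2 Ei Yi h hi|i a e e1 Ei Yi h hi].
- have eF : F e =m F e' by apply: F1 => i /(du_vars_l du); apply: h.
  have eH : H e =m H e' by apply: H1 => i /(du_vars_r du); apply: h.
  by rewrite (cl _ _ _ eF) (cr _ _ _ eH).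
- case: (du_cases du Ei) => -[Xi nXi].
  + have eH1 : H e =m H e1 by apply: H1 => j /(other _ _ _ Yi nXi) /h [].
    have eH2 : H e =m H e2 by apply: H1 => j /(other _ _ _ Yi nXi) /h [].
    rewrite (cl _ _ _ (F2 _ _ _ _ Xi Yi h hi)) (lin_add (opl _)).
    by rewrite (cr _ _ _ eH1) -(cr _ _ _ eH2) (cr _ _ _ eH1).
  + have eF1 : F e =m F e1 by apply: F1 => j /(other _ _ _ Yi nXi) /h [].
    have eF2 : F e =m F e2 by apply: F1 => j /(other _ _ _ Yi nXi) /h [].
    rewrite (cr _ _ _ (H2 _ _ _ _ Xi Yi h hi)) (lin_add (opr _)).
    by rewrite (cl _ _ _ eF1) -(cl _ _ _ eF2) (cl _ _ _ eF1).
- case: (du_cases du Ei) => -[Xi nXi].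
  + have eH : H e =m H e1 by apply: H1 => j /(other _ _ _ Yi nXi) /h.
    rewrite (cl _ _ _ (F3 _ _ _ _ Xi Yi h hi)) (lin_scal (opl _)).
    by rewrite (cr _ _ _ eH).
  + have eF : F e =m F e1 by apply: F1 => j /(other _ _ _ Yi nXi) /h.
    rewrite (cr _ _ _ (H3 _ _ _ _ Xi Yi h hi)) (lin_scal (opr _)).
    by rewrite (cl _ _ _ eF).
Qed.

End Env.

(** * Currying over a bound variable *)

Lemma ml_slice g Y G A M (F : env (tcons A g) -> M) (e : env g) :
  multilinear (None :: Y) (Some A :: G) F ->
  is_linear (fun m => F (econs m e)).
Proof.
move=> [F1 F2 F3]; split=> [m m' h|m m'|a m].
- by apply: F1 => -[|i].
- by apply: (F2 0) => // -[].
- by apply: (F3 0) => // -[].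
Qed.

Definition curry g Y G A M (F : env (tcons A g) -> M)
    (hF : multilinear (None :: Y) (Some A :: G) F) (e : env g) : hom (interp A) M :=
  LinMap (ml_slice e hF).

Lemma ml_curry g Y G A M (F : env (tcons A g) -> M)
    (hF : multilinear (None :: Y) (Some A :: G) F) :
  multilinear Y G (curry hF).
Proof.
case: (hF) => [F1 F2 F3].
split=> [e e' h|i e e1 e2 Gi Yi h hi|i a e e1 Gi Yi h hi] m /=.
- by apply: F1 => -[|i] //=; apply: h.
- by apply: (F2 i.+1) => // -[|j] //=; apply: h.
- by apply: (F3 i.+1) => // -[|j] //=; apply: h.
Qed.

Lemma ml_slice_int g Y D A M (F : env (tcons A g) -> M) (e : env g) :
  multilinear (Some A :: Y) (None :: D) F ->
  Proper (@eqm _ (interp A) ==> @eqm _ M) (fun m => F (econs m e)).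
Proof. by move=> [F1 _ _] m m' h; apply: F1 => -[|i]. Qed.

Definition curry_int g Y D A M (F : env (tcons A g) -> M)
    (hF : multilinear (Some A :: Y) (None :: D) F) (e : env g) : maps (interp A) M :=
  SetoidMap (ml_slice_int e hF).

Lemma ml_curry_int g Y D A M (F : env (tcons A g) -> M)
    (hF : multilinear (Some A :: Y) (None :: D) F) :
  multilinear Y D (curry_int hF).
Proof.
case: (hF) => [F1 F2 F3].
split=> [e e' h|i e e1 e2 Gi Yi h hi|i a e e1 Gi Yi h hi] m /=.
- by apply: F1 => -[|i] //=; apply: h.
- by apply: (F2 i.+1) => // -[|j] //=; apply: h.
- by apply: (F3 i.+1) => // -[|j] //=; apply: h.
Qed.

(** * Soundness *)

Definition agrees (G : context) (g : nat -> proposition) : Prop :=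
  forall i A, lookup G i = Some A -> g i = A.

Lemma agrees_cons o G A g :
  (forall B, o = Some B -> A = B) -> agrees G g -> agrees (o :: G) (tcons A g).
Proof. by move=> h hG [|i] B /=; [exact: h | exact: hG]. Qed.

Definition env_real (Y G : context) g (s : nat -> term S) (e : env g) : Prop :=
  forall i, lookup Y i || lookup G i -> real (s i) (e i).

(** Leaving both new entries arbitrary covers linear and intuitionistic binders at once. *)
Lemma env_real_cons (oY oG : option proposition) (Y G : context) g s (e : env g) A u (m : interp A) :
  real u m -> env_real Y G s e ->
  env_real (oY :: Y) (oG :: G) (scons u s) (econs m e).
Proof. by move=> hu hs [|i] //=; apply: hs. Qed.

(** [F] is existentially quantified because it is built from the typing derivation, which lives in
    [Prop]. It is chosen before [s] and [e], so that one multilinear map serves all closing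
    substitutions. *)
Definition sound (Y G : context) (t : term S) A g : Prop :=
  exists2 F : env g -> interp A, multilinear Y G F &
    forall s e, env_real Y G s e -> real (subst s t) (F e).

(** Induction on the derivation. Apart from [DZero], a rule that splits the linear context becomes a
    bilinear operation; sharing a context goes through a product, and bound variables are curried.
    On the side of terms, [real_equiv] undoes the reduction of each redex. *)
Lemma fundamental Y G t A g :
  typed Y G t A -> agrees Y g -> agrees G g -> sound Y G t A g.
Proof.
have du_agree_l (G' D E : context) g' : disjoint_union G' D E -> agrees E g' -> agrees G' g'.
  by move=> du hE i B hi; apply: hE; rewrite (du_l du) hi.
have du_agree_r (G' D E : context) g' : disjoint_union G' D E -> agrees E g' -> agrees D g'.
  by move=> du hE i B hi; apply: hE; rewrite (du_r du) hi.
have du_real_l Y' (G' D E : context) g' s (e : env g') :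
    disjoint_union G' D E -> env_real Y' E s e -> env_real Y' G' s e.
  by move=> du hs i /(du_vars_l du); apply: hs.
have du_real_r Y' (G' D E : context) g' s (e : env g') :
    disjoint_union G' D E -> env_real Y' E s e -> env_real Y' D s e.
  by move=> du hs i /(du_vars_r du); apply: hs.
have consS A' (G' : context) g' : agrees G' g' -> agrees (Some A' :: G') (tcons A' g').
  by apply: agrees_cons => B [].
have consN A' (G' : context) g' : agrees G' g' -> agrees (None :: G') (tcons A' g').
  exact: agrees_cons.
move=> ht; elim: ht g => {Y G t A}.
- move=> Y G i A hG g aY aG.
  have e : g i = A by apply: aG; rewrite hG eqxx.
  (* Identifying [A] with [g i] lets the projection at [i] have the required type. *)
  case: A / e hG => hG; exists (fun e => e i).
    split=> [e e' h|j e e1 e2|j a e e1]; first by apply: h; rewrite hG eqxx orbT.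
    + by rewrite hG; case: eqP => // ->.
    + by rewrite hG; case: eqP => // ->.
  by move=> s e hs; apply: hs; rewrite hG eqxx orbT.
- move=> Y G i A hY hG g aY aG.
  have e := aY _ _ hY; case: A / e hY => hY; exists (fun e => e i).
    split=> [e e' h|j e e1 e2|j a e e1]; first by apply: h; rewrite hY.
    + by rewrite hG.
    + by rewrite hG.
  by move=> s e hs; apply: hs; rewrite hY.
- move=> Y G t u A _ IHt _ IHu g aY aG.
  have [F hF rF] := IHt g aY aG; have [H hH rH] := IHu g aY aG.
  exists (fun e => F e +m H e); last by move=> s e hs; apply: real_add; auto.
  (* The two summands share their linear context, so addition enters as one linear map on the
     product. *)
  have add_linear : is_linear (fun p : product (interp A) (interp A) => p.1 +m p.2).
    split=> [p q [e1 e2]|p q|a p] /=; first by rewrite e1 e2.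
    - exact: addmACA.
    - by rewrite scalmDr.
  exact: ml_linear add_linear (ml_pair hF hH).
- move=> Y G a t A _ IHt g aY aG; have [F hF rF] := IHt g aY aG.
  exists (fun e => a *m F e); last by move=> s e hs; apply: real_scal; auto.
  exact: (ml_linear ((scal_bilinear _).2 a)).
- move=> Y G a hG g aY aG; exists (fun=> a : interp One); last by move=> s e _; apply: rst_refl.
  by split=> [//|i e e1 e2|i b e e1]; rewrite hG.
- move=> Y G D E t u A du _ IHt _ IHu g aY aE.
  have [F hF rF] := IHt g aY (du_agree_l _ _ _ _ du aE).
  have [H hH rH] := IHu g aY (du_agree_r _ _ _ _ du aE).
  exists (fun e => F e *m H e); first exact: ml_bilinear du (scal_bilinear _) hF hH.
  move=> s e hs.
  have := real_scal (F e) (rH _ _ (du_real_r _ _ _ _ _ _ _ du hs)).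
  apply: real_equiv; symmetry => /=.
  have := rF _ _ (du_real_l _ _ _ _ _ _ _ du hs) => /= et.
  transitivity (DOne (Star (F e)) (subst s u)); last exact/head_equiv/R_One.
  by apply: (equiv_ctx (C := fun t => DOne t _)) et => *; apply: step_DOne1.
- move=> Y G A B t _ IHt g aY aG.
  have [F hF rF] := IHt _ (consN A _ _ aY) (consS _ _ _ aG).
  exists (curry hF); first exact: ml_curry.
  move=> s e hs; split; first by exists (subst (up_sub s) t).
  move=> u m hu; apply: (real_equiv _ (rF _ _ (env_real_cons hu hs))).
  by symmetry; rewrite /= (head_equiv (R_Beta _ _ _)) subst1_up.
- move=> Y G D E t u A B du _ IHt _ IHu g aY aE.
  have [F hF rF] := IHt g aY (du_agree_l _ _ _ _ du aE).
  have [H hH rH] := IHu g aY (du_agree_r _ _ _ _ du aE).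
  exists (fun e => (F e : hom _ _) (H e)); first exact: ml_bilinear du (app_bilinear _ _) hF hH.
  move=> s e hs.
  apply: (rF _ _ (du_real_l _ _ _ _ _ _ _ du hs)).2.
  exact: rH _ _ (du_real_r _ _ _ _ _ _ _ du hs).
- move=> Y G D E t u A B du _ IHt _ IHu g aY aE.
  have [F hF rF] := IHt g aY (du_agree_l _ _ _ _ du aE).
  have [H hH rH] := IHu g aY (du_agree_r _ _ _ _ du aE).
  exists (fun e => Leaf (F e, H e)); first exact: ml_bilinear du (tensor_bilinear _ _) hF hH.
  move=> s e hs; exists (subst s t), (subst s u); split=> //.
  + exact: rF _ _ (du_real_l _ _ _ _ _ _ _ du hs).
  + exact: rH _ _ (du_real_r _ _ _ _ _ _ _ du hs).
- move=> Y G D E t u A B C du _ IHt _ IHu g aY aE.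
  have [F hF rF] := IHt g aY (du_agree_l _ _ _ _ du aE).
  have aD := du_agree_r _ _ _ _ du aE.
  have [H hH rH] := IHu _ (consN B _ _ (consN A _ _ aY)) (consS _ _ _ (consS _ _ _ aD)).
  (* Index 0 is the variable of type [B]: the inner currying abstracts it, the outer one abstracts
     the variable of type [A]. *)
  exists (fun e => fold (fun xy => (curry (ml_curry hH) e : hom _ (hom _ _)) xy.1 xy.2) (F e)).
    exact: ml_bilinear du (tensor_elim_bilinear _ _ _) hF (ml_curry (ml_curry hH)).
  move=> s e hs; have := rF _ _ (du_real_l _ _ _ _ _ _ _ du hs).
  apply: (treal_fold (C := fun t => DTensor t A B _)) => [*|*|*|k [x y] [v [w [ek hv hw]]]].
  + exact: step_DTensor1.
  + exact: R_SumTensor.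
  + exact: R_ScalTensor.
  have hs' := du_real_r _ _ _ _ _ _ _ du hs.
  apply: (real_equiv _ (rH _ _ (env_real_cons hw (env_real_cons hv hs')))).
  rewrite -subst2_up; symmetry.
  transitivity (DTensor (Tens v w) A B (subst (up_sub (up_sub s)) u)).
    by apply: (equiv_ctx (C := fun t => DTensor t A B _)) ek => *; apply: step_DTensor1.
  exact/head_equiv/R_Tensor.
- move=> Y G g aY aG; exists (fun=> tt : interp Top); first by split.
  by move=> s e _; apply: rst_refl.
- move=> Y G D E t C du _ IHt g aY aE.
  have [F hF rF] := IHt g aY (du_agree_l _ _ _ _ du aE).
  (* [F e] lies in the empty type, so every obligation is vacuous. *)
  exists (fun e => match F e with end).
    by split=> [e|i e|i a e]; case: (F e).
  by move=> s e _; case: (F e).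
- move=> Y G t u A B _ IHt _ IHu g aY aG.
  have [F hF rF] := IHt g aY aG; have [H hH rH] := IHu g aY aG.
  exists (fun e => (F e, H e)); first exact: ml_pair.
  by move=> s e hs; exists (subst s t), (subst s u); split; [exact: rst_refl|exact: rF|exact: rH].
- move=> Y G D E t u A B C du _ IHt _ IHu g aY aE.
  have [F hF rF] := IHt g aY (du_agree_l _ _ _ _ du aE).
  have [H hH rH] := IHu _ (consN A _ _ aY) (consS _ _ _ (du_agree_r _ _ _ _ du aE)).
  exists (fun e => curry hH e (F e).1).
    exact: ml_bilinear du (proj_bilinear1 _ _ _) hF (ml_curry hH).
  move=> s e hs; have [v [w [ek hv _]]] := rF _ _ (du_real_l _ _ _ _ _ _ _ du hs).
  have hs' := du_real_r _ _ _ _ _ _ _ du hs.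
  apply: (real_equiv _ (rH _ _ (env_real_cons hv hs'))).
  rewrite -subst1_up; symmetry.
  transitivity (DWith1 (Pair v w) A (subst (up_sub s) u)).
    by apply: (equiv_ctx (C := fun t => DWith1 t A _)) ek => *; apply: step_DWith11.
  exact/head_equiv/R_With1.
- move=> Y G D E t u A B C du _ IHt _ IHu g aY aE.
  have [F hF rF] := IHt g aY (du_agree_l _ _ _ _ du aE).
  have [H hH rH] := IHu _ (consN B _ _ aY) (consS _ _ _ (du_agree_r _ _ _ _ du aE)).
  exists (fun e => curry hH e (F e).2).
    exact: ml_bilinear du (proj_bilinear2 _ _ _) hF (ml_curry hH).
  move=> s e hs; have [v [w [ek _ hw]]] := rF _ _ (du_real_l _ _ _ _ _ _ _ du hs).
  have hs' := du_real_r _ _ _ _ _ _ _ du hs.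
  apply: (real_equiv _ (rH _ _ (env_real_cons hw hs'))).
  rewrite -subst1_up; symmetry.
  transitivity (DWith2 (Pair v w) B (subst (up_sub s) u)).
    by apply: (equiv_ctx (C := fun t => DWith2 t B _)) ek => *; apply: step_DWith21.
  exact/head_equiv/R_With2.
- move=> Y G t A B _ IHt g aY aG; have [F hF rF] := IHt g aY aG.
  exists (fun e => Leaf (inl (F e))); first exact: ml_linear (inl_linear _ _) hF.
  by move=> s e hs; exists (subst s t); [exact: rst_refl|exact: rF].
- move=> Y G t A B _ IHt g aY aG; have [F hF rF] := IHt g aY aG.
  exists (fun e => Leaf (inr (F e))); first exact: ml_linear (inr_linear _ _) hF.
  by move=> s e hs; exists (subst s t); [exact: rst_refl|exact: rF].
- move=> Y G D E t u v A B C du _ IHt _ IHu _ IHv g aY aE.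
  have [F hF rF] := IHt g aY (du_agree_l _ _ _ _ du aE).
  have aD := du_agree_r _ _ _ _ du aE.
  have [H hH rH] := IHu _ (consN A _ _ aY) (consS _ _ _ aD).
  have [K hK rK] := IHv _ (consN B _ _ aY) (consS _ _ _ aD).
  exists (fun e => fold (case_sum (curry hH e, curry hK e)) (F e)).
    exact: ml_bilinear du (plus_elim_bilinear _ _ _) hF (ml_pair (ml_curry hH) (ml_curry hK)).
  move=> s e hs; have := rF _ _ (du_real_l _ _ _ _ _ _ _ du hs).
  have hs' := du_real_r _ _ _ _ _ _ _ du hs.
  apply: (treal_fold (C := fun t => DPlus t A _ B _)) => [*|*|*|k [x|x] [w ek hw]].
  + exact: step_DPlus1.
  + exact: R_SumPlus.
  + exact: R_ScalPlus.
  + apply: (real_equiv _ (rH _ _ (env_real_cons hw hs'))).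
    rewrite -subst1_up; symmetry.
    transitivity (DPlus (Inl w) A (subst (up_sub s) u) B (subst (up_sub s) v)).
      by apply: (equiv_ctx (C := fun t => DPlus t A _ B _)) ek => *; apply: step_DPlus1.
    exact/head_equiv/R_PlusL.
  + apply: (real_equiv _ (rK _ _ (env_real_cons hw hs'))).
    rewrite -subst1_up; symmetry.
    transitivity (DPlus (Inr w) A (subst (up_sub s) u) B (subst (up_sub s) v)).
      by apply: (equiv_ctx (C := fun t => DPlus t A _ B _)) ek => *; apply: step_DPlus1.
    exact/head_equiv/R_PlusR.
- move=> Y G t A hG _ IHt g aY aG; have [F [F1 _ _] rF] := IHt g aY aG.
  exists (fun e => Leaf (F e)); last by move=> s e hs; exists (subst s t); [exact: rst_refl|exact: rF].
  (* Forming a generator is not linear, but the linear context is empty, so only congruence is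
     left. *)
  split=> [e e' h|i e e1 e2|i a e e1]; try by rewrite hG.
  by apply: teq_gen; apply: bang_congr; apply: F1.
- move=> Y G D E t u A B du _ IHt _ IHu g aY aE.
  have [F hF rF] := IHt g aY (du_agree_l _ _ _ _ du aE).
  have [H hH rH] := IHu _ (consS A _ _ aY) (consN A _ _ (du_agree_r _ _ _ _ du aE)).
  exists (fun e => fold (curry_int hH e) (F e)).
    exact: ml_bilinear du (bang_elim_bilinear _ _) hF (ml_curry_int hH).
  move=> s e hs; have := rF _ _ (du_real_l _ _ _ _ _ _ _ du hs).
  have hs' := du_real_r _ _ _ _ _ _ _ du hs.
  apply: (treal_fold (C := fun t => DBang t A _)) => [*|*|*|k x [w ek hw]].
  + exact: step_DBang1.
  + exact: R_SumBang.
  + exact: R_ScalBang.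
  apply: (real_equiv _ (rH _ _ (env_real_cons hw hs'))).
  rewrite -subst1_up; symmetry.
  transitivity (DBang (Bang w) A (subst (up_sub s) u)).
    by apply: (equiv_ctx (C := fun t => DBang t A _)) ek => *; apply: step_DBang1.
  exact/head_equiv/R_Bang.
Qed.

Lemma closed_real (t : term S) A : closed_proof t A -> exists m : interp A, real t m.
Proof.
move=> ht; have h : agrees [::] (fun=> One) by move=> [|i].
have [F _ rF] := fundamental ht h h.
(* No index is declared, so an arbitrary environment will do. *)
pose e : env (fun=> One) := fun=> (0%R : S).
exists (F e); rewrite -(subst_Var t (fun i => erefl)).
by apply: rF => -[|i].
Qed.

End Semimodules.

Theorem theorem2p30 (S : comPzSemiRingType) (A B : proposition)
    (f u1 u2 : term S) (a : S)
    (hB : inV B)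
    (hf : closed_proof f (Lolli A B))
    (hu1 : closed_proof u1 A)
    (hu2 : closed_proof u2 A) :
  term_equiv (App f (Sum u1 u2)) (Sum (App f u1) (App f u2)) /\
  term_equiv (App f (Scal a u1)) (Scal a (App f u1)).
Proof.
have [m [_ hm]] := closed_real hf.
have [x hx] := closed_real hu1; have [y hy] := closed_real hu2.
(* In each half, the two sides realize elements that are equal by linearity of [m], and [real_inV]
   turns this equality into conversion. *)
split.
- apply: real_inV hB (lin_add (lfunP m) x y) (hm _ _ (real_add hx hy)) _.
  exact: real_add (hm _ _ hx) (hm _ _ hy).
- apply: real_inV hB (lin_scal (lfunP m) a x) (hm _ _ (real_scal a hx)) _.
  exact: real_scal (hm _ _ hx).
Qed.
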